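(* Let $f$ be a convex differentiable real-valued function on the space $\mathbb{S}^{n\times n}$ of symmetric real $n\times n$ matrices, with finite curvature constant $C_f$ with respect to the spectahedron $\mathcal{S}:=\{X\in\mathbb{S}^{n\times n} : X\succeq0,\ \mathrm{Tr}(X)=1\}$. Let $X^*\in\mathcal{S}$ be an optimal solution of $\min_{X\in\mathcal{S}}f(X)$. For each $k\ge1$, the iterate $X^{(k)}$ of the algorithm ''Sparse Greedy for Bounded Trace'' satisfies $$f(X^{(k)})-f(X^* )\le\frac{8C_f}{k+2}.$$ Furthermore, for any $\varepsilon>0$, after at most $2\left\lceil\frac{8C_f}{\varepsilon}\right\rceil+1=O\left(\frac1\varepsilon\right)$ many steps, the algorithm (with the step-size in the second half of the iterations fixed to $\frac{2}{K+2}$, where $K:=\lceil8C_f/\varepsilon\rceil$) has an iterate $X^{(k)}$ of rank $O\left(\frac1\varepsilon\right)$, satisfying $g(X^{(k)})\le\varepsilon$.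
   Context: $\mathbb{S}^{n\times n}$ carries the Frobenius inner product $A\bullet B:=\mathrm{Tr}(A^TB)$, with respect to which gradients are taken, so that $\nabla f(X)\in\mathbb{S}^{n\times n}$. The $O(\cdot)$ is for $\varepsilon\to0$, with constant depending only on $C_f$. Curvature constant: $$C_f:=\sup_{\substack{X,V\in\mathcal{S},\ \alpha\in(0,1],\\ Y=X+\alpha(V-X)}}\frac{1}{\alpha^2}\bigl(f(Y)-f(X)-(Y-X)\bullet\nabla f(X)\bigr).$$ Duality gap at $X\in\mathcal{S}$: $g(X):=\max_{Y\in\mathcal{S}}(X-Y)\bullet\nabla f(X)=X\bullet\nabla f(X)-\lambda_{\min}(\nabla f(X))$. Algorithm ''Sparse Greedy for Bounded Trace'' (Hazan's algorithm): set $X^{(0)}:=vv^T$ for an arbitrary unit vector $v\in\mathbb{R}^n$. For $k=0,1,2,\dots$: let $\alpha:=\frac{2}{k+2}$; compute $v:=\mathrm{ApproxEV}(\nabla f(X^{(k)}),\alpha C_f)$; update $X^{(k+1)}:=X^{(k)}+\alpha(vv^T-X^{(k)})$. Here $\mathrm{ApproxEV}(A,\varepsilon')$ returns any unit vector $v\in\mathbb{R}^n$ with $v^TAv\le\lambda_{\min}(A)+\varepsilon'$. For the duality gap statement, the step-sizes are $\alpha=\frac{2}{k+2}$ for $0\le k\le K$ and $\alpha=\frac{2}{K+2}$ for $K\le k\le2K+1$ (also in the accuracy $\alpha C_f$). *)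

(* Defs.v *)
From HB Require Import structures.
From mathcomp Require Import all_boot all_order all_algebra.
From mathcomp Require Import sesquilinear.
From mathcomp Require Import all_classical all_reals all_analysis.
From mathcomp Require Import ring lra.

Set Implicit Arguments.
Unset Strict Implicit.
Unset Printing Implicit Defensive.

Import Order.TTheory GRing.Theory Num.Theory.
Import numFieldNormedType.Exports.

Local Open Scope classical_set_scope.
Local Open Scope ring_scope.

Section SymmetricMatrices.
Variables (R : realType) (n : nat).

Record symmx := SymMx { symmx_val :> 'M[R]_n; _ : symmx_val \is symmetricmx }.

HB.instance Definition _ := [isSub for symmx_val].
HB.instance Definition _ := [Choice of symmx by <:].

Lemma symmetricmxP (A : 'M[R]_n) : reflect (A^T = A) (A \is symmetricmx).
Proof.
rewrite is_hermitianmxE expr0 scale1r map_mx_id//.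
by rewrite eq_sym; apply: eqP.
Qed.

Fact symmetricmx_submod_closed :
  submod_closed [pred A : 'M[R]_n | A \is symmetricmx].
Proof.
split=> [|a A B]; rewrite !inE; first by apply/symmetricmxP; rewrite trmx0.
move=> /symmetricmxP As /symmetricmxP Bs; apply/symmetricmxP.
by rewrite linearP/= As Bs.
Qed.

HB.instance Definition _ :=
  GRing.SubChoice_isSubLmodule.Build R 'M[R]_n _ symmx
    symmetricmx_submod_closed.

Definition frobenius (A B : symmx) : R :=
  \tr ((symmx_val A)^T *m symmx_val B).

Lemma frobeniusE (A B : symmx) :
  frobenius A B = \sum_i \sum_j symmx_val A i j * symmx_val B i j.
Proof.
rewrite exchange_big; apply: eq_bigr => i _; rewrite mxE.
by apply: eq_bigr => j _; rewrite mxE.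
Qed.

Lemma frobeniusC (A B : symmx) : frobenius A B = frobenius B A.
Proof.
by rewrite !frobeniusE; do 2 (apply: eq_bigr => ? _); rewrite mulrC.
Qed.

Lemma frobeniusDl (A B C : symmx) :
  frobenius (A + B) C = frobenius A C + frobenius B C.
Proof. by rewrite /frobenius !linearD/= mulmxDl linearD. Qed.

Lemma frobeniusZl (a : R) (A B : symmx) :
  frobenius (a *: A) B = a * frobenius A B.
Proof. by rewrite /frobenius !linearZ/= -scalemxAl linearZ. Qed.

Lemma frobenius_ge0 (A : symmx) : 0 <= frobenius A A.
Proof.
by rewrite frobeniusE; do 2 (apply: sumr_ge0 => ? _); rewrite -expr2 sqr_ge0.
Qed.

Lemma frobenius_eq0 (A : symmx) : frobenius A A = 0 -> A = 0.
Proof.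
rewrite frobeniusE => A0; apply: val_inj; apply/matrixP => i j; rewrite mxE.
have sq_ge0 k l : 0 <= symmx_val A k l * symmx_val A k l.
  by rewrite -expr2 sqr_ge0.
have /(_ i isT) Ai0 :=
  psumr_eq0P (fun k _ => sumr_ge0 _ (fun l _ => sq_ge0 k l)) A0.
have /(_ j isT) /eqP := psumr_eq0P (fun l _ => sq_ge0 i l) Ai0.
by rewrite mulf_eq0 orbb => /eqP.
Qed.

Lemma frobenius_CauchySchwarz (A B : symmx) :
  frobenius A B ^+ 2 <= frobenius A A * frobenius B B.
Proof.
have [/frobenius_eq0 ->|B0] := eqVneq (frobenius B B) 0.
  rewrite frobeniusC -(scale0r (0 : symmx)) !frobeniusZl !mul0r expr0n/=.
  by rewrite mulr0.
have Bgt0 : 0 < frobenius B B by rewrite lt_neqAle eq_sym B0 frobenius_ge0.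
rewrite -subr_ge0 -(pmulr_rge0 _ Bgt0).
have := frobenius_ge0 (frobenius B B *: A + - frobenius A B *: B).
rewrite frobeniusDl !frobeniusZl.
rewrite ![frobenius _ (_ + _)]frobeniusC !frobeniusDl !frobeniusZl.
rewrite (frobeniusC B A); congr (0 <= _); ring.
Qed.

Definition frobenius_norm (A : symmx) : R := Num.sqrt (frobenius A A).

Lemma ler_frobenius_normD (A B : symmx) :
  frobenius_norm (A + B) <= frobenius_norm A + frobenius_norm B.
Proof.
have N0 C : 0 <= frobenius_norm C by exact: sqrtr_ge0.
rewrite -ler_sqr ?nnegrE ?addr_ge0// sqrrD !sqr_sqrtr ?frobenius_ge0//.
have AB : frobenius A B <= frobenius_norm A * frobenius_norm B.
  apply: le_trans (ler_norm _) _.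
  rewrite -ler_sqr ?nnegrE ?mulr_ge0// real_normK ?num_real// exprMn.
  by rewrite !sqr_sqrtr ?frobenius_ge0// frobenius_CauchySchwarz.
rewrite frobeniusDl ![frobenius _ (_ + _)]frobeniusC !frobeniusDl.
rewrite (frobeniusC B A); lra.
Qed.

Lemma frobenius_normZ (a : R) (A : symmx) :
  frobenius_norm (a *: A) = `|a| * frobenius_norm A.
Proof.
rewrite /frobenius_norm frobeniusZl frobeniusC frobeniusZl mulrA -expr2.
by rewrite sqrtrM ?sqr_ge0// sqrtr_sqr.
Qed.

Lemma frobenius_norm_eq0 (A : symmx) : frobenius_norm A = 0 -> A = 0.
Proof.
move=> /eqP; rewrite sqrtr_eq0 => A0; apply: frobenius_eq0.
by apply/le_anti; rewrite A0 frobenius_ge0.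
Qed.

HB.instance Definition _ := Lmodule_isNormed.Build R symmx
  ler_frobenius_normD frobenius_normZ frobenius_norm_eq0.

Lemma outer_symmetric (v : 'cV[R]_n) : v *m v^T \is symmetricmx.
Proof. by apply/symmetricmxP; rewrite trmx_mul trmxK. Qed.

Definition outer (v : 'cV[R]_n) : symmx := SymMx (outer_symmetric v).

Definition quadratic_form (A : 'M[R]_n) (v : 'cV[R]_n) : R :=
  (v^T *m A *m v) 0 0.

Definition positive_semidefinite (A : 'M[R]_n) : Prop :=
  forall v : 'cV[R]_n, 0 <= quadratic_form A v.

Definition spectahedron : set symmx :=
  [set X : symmx | positive_semidefinite X /\ \tr (symmx_val X) = 1].

Definition unit_vector (v : 'cV[R]_n) : Prop := \sum_i v i 0 ^+ 2 = 1.

(* For n > 0 the spectrum of a symmetric real matrix is finite and nonempty,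
   so that this infimum is a minimum. *)
Definition lambda_min (A : symmx) : R :=
  inf [set l : R | eigenvalue (symmx_val A) l].

(* The Riesz representative of the differential of f at X for the Frobenius
   inner product (unique when f is differentiable at X). *)
Definition gradient (f : symmx -> R) (X : symmx) : symmx :=
  get [set G | forall H, 'd f X H = frobenius H G].

(* Extended-real valued, so that finiteness is a hypothesis. *)
Definition curvature (f : symmx -> R) : \bar R :=
  ereal_sup [set c | exists X V (a : R),
    [/\ spectahedron X, spectahedron V, 0 < a <= 1 &
        let Y := X + a *: (V - X) in
        c = (1 / a ^+ 2 *
             (f Y - f X - frobenius (Y - X) (gradient f X)))%:E]].

(* The supremum is attained: the spectahedron is compact. *)
Definition duality_gap (f : symmx -> R) (X : symmx) : R :=
  sup [set frobenius (X - Y) (gradient f X) | Y in spectahedron].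

Definition minimizer (f : symmx -> R) (X : symmx) : Prop :=
  spectahedron X /\ forall Y, spectahedron Y -> f X <= f Y.

Definition approx_ev (A : symmx) (e : R) (v : 'cV[R]_n) : Prop :=
  unit_vector v /\ quadratic_form A v <= lambda_min A + e.

(* X is the sequence of iterates of some execution with step sizes a: the
   starting vector and the outputs of the approximate eigenvector oracle are
   arbitrary. *)
Definition sparse_greedy (f : symmx -> R) (a : nat -> R) (X : nat -> symmx) :
    Prop :=
  (exists2 v, unit_vector v & X 0%N = outer v) /\
  forall k, exists2 v,
    approx_ev (gradient f (X k)) (a k * fine (curvature f)) v &
    X k.+1 = X k + a k *: (outer v - X k).

End SymmetricMatrices.

Section StepSizes.
Variable R : realType.

Definition step_size (k : nat) : R := 2 / (k%:R + 2).

Definition step_size_upto (K k : nat) : R :=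
  if (k <= K)%N then step_size k else step_size K.

(* The integer ceiling is nonnegative when 0 <= C and 0 < e, and then absz is
   the identity on it. *)
Definition half_steps (C e : R) : nat := `|Num.ceil (8 * C / e)|%N.

End StepSizes.

(* Main.v *)
Require Import Defs.
From mathcomp Require Import all_boot all_order all_algebra.
From mathcomp Require Import all_classical all_reals all_analysis.
From mathcomp Require Import ring lra.

Import Order.TTheory GRing.Theory Num.Theory.
Import numFieldNormedType.Exports.

Local Open Scope classical_set_scope.
Local Open Scope ring_scope.

(** Write G for the gradient of f at X. Everything is measured against the
    eigenvalue gap X . G - lambda_min(G). Since the smallest eigenvalue of G is
    at most Y . G for every Y of the spectahedron ([lambda_min_le]), this number
    is an upper bound of the duality gap; by convexity ([convex_gradient_ineq])
    it is also an upper bound of f X - f Xs.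

    One step moves X towards a rank one vertex v v^T whose slope v^T G v is
    at most lambda_min(G) + a C. By definition of the curvature, this leads to
    [greedy_step_descent]: f decreases by a times the eigenvalue gap, up to an
    error of a^2 C for the curvature and another a^2 C for the inexact
    eigenvector.

    Primal convergence: bounding the eigenvalue gap below by h = f X - f Xs
    gives h' <= (1 - a) h + 2 a^2 C, which with a = 2 / (k + 2) propagates the
    bound 8 C / (k + 2) ([suboptimality_bound_step]). The first step has a = 1
    and forgets the starting point, so the induction starts at k = 1.

    Duality gap: after K + 1 steps h is at most 8 C / (K + 3). If the gap were
    larger than e at all of X (K + 1), ..., X (2 K + 1), then the K + 1 steps of
    length 2 / (K + 2) from these iterates would decrease h by more than that
    ([total_decrease_lt], where 8 C / e <= K enters), and f would fall below
    its minimum. Each step raises the rank by at most one, so these iterates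
    have rank at most 2 K + 2.

    The matrix analysis behind [lambda_min_le] is elementary: the minimum of the
    quadratic form on the unit sphere is attained by compactness and is an
    eigenvalue, and the trace of a product of two positive semidefinite matrices
    is nonnegative, as one sees by peeling rank one terms off the first. *)

(** * Positive semidefinite matrices *)

Section QuadraticForms.
Context {R : realType} {n : nat}.
Implicit Types (A P Q : 'M[R]_n) (u v w : 'cV[R]_n) (X Y : symmx R n).

Lemma symmx_sym X : (symmx_val X)^T = symmx_val X.
Proof. by case: X => X /= /symmetricmxP. Qed.

Lemma bilinear_formC {A} u v :
  A^T = A -> (u^T *m A *m v) 0 0 = (v^T *m A *m u) 0 0.
Proof.
move=> As; rewrite -[in LHS](trmxK (u^T *m A *m v)) [in LHS]mxE.
by rewrite !trmx_mul trmxK As mulmxA.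
Qed.

Lemma mx11D (M N : 'M[R]_1) : (M + N) 0 0 = M 0 0 + N 0 0.
Proof. by rewrite mxE. Qed.

Lemma mx11Z (t : R) (M : 'M[R]_1) : (t *: M) 0 0 = t * M 0 0.
Proof. by rewrite mxE. Qed.

Lemma quadratic_formDZ {A} u v (t : R) : A^T = A ->
  quadratic_form A (u + t *: v) =
  quadratic_form A u + 2 * t * (u^T *m A *m v) 0 0 +
  t ^+ 2 * quadratic_form A v.
Proof.
move=> As; rewrite /quadratic_form.
have -> : (u + t *: v)^T = u^T + t *: v^T by rewrite linearD linearZ.
rewrite !mulmxDl !mulmxDr.
rewrite -!scalemxAl -!scalemxAr !mx11D !mx11Z.
rewrite (bilinear_formC v u As).
by ring.
Qed.

Lemma quadratic_formZ A (t : R) v :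
  quadratic_form A (t *: v) = t ^+ 2 * quadratic_form A v.
Proof.
have vtT : (t *: v)^T = t *: v^T by rewrite linearZ.
rewrite /quadratic_form vtT -!scalemxAl -scalemxAr.
by rewrite !mx11Z mulrA expr2.
Qed.

Lemma trace_outer_mul v A : \tr ((v *m v^T) *m A) = quadratic_form A v.
Proof. by rewrite -mulmxA mxtrace_mulC [LHS]trace_mx11. Qed.

Lemma quadratic_form_delta A i : quadratic_form A (delta_mx i 0) = A i i.
Proof. by rewrite /quadratic_form trmx_delta -rowE -colE !mxE. Qed.

Lemma trmx_mul_ge0 v : 0 <= (v^T *m v) 0 0.
Proof. by rewrite mxE sumr_ge0// => i _; rewrite mxE -expr2 sqr_ge0. Qed.

Lemma trmx_mulE_sum v : (v^T *m v) 0 0 = \sum_i v i 0 ^+ 2.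
Proof. by rewrite mxE; apply: eq_bigr => i _; rewrite mxE expr2. Qed.

Lemma trmx_mul_eq0 v : (v^T *m v) 0 0 = 0 -> v = 0.
Proof.
rewrite trmx_mulE_sum => /psumr_eq0P v0; apply/colP => i; rewrite mxE.
by apply/eqP; rewrite -sqrf_eq0 v0// => j _; exact: sqr_ge0.
Qed.

Lemma quadratic_form_outer w v :
  quadratic_form (w *m w^T) v = ((v^T *m w) 0 0) ^+ 2.
Proof.
rewrite /quadratic_form -mulmxA -mulmxA mulmxA [LHS]mxE big_ord1 expr2.
congr (_ * _); rewrite -[in LHS](trmxK (w^T *m v)) [in LHS]mxE.
by rewrite trmx_mul trmxK.
Qed.

(** At u + t v the form is affine in t, with slope 2 u^T P v. As it is
    nonnegative for all t, the slope is 0, for every u. *)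
Lemma psd_kernel {P v} : P^T = P -> positive_semidefinite P ->
  quadratic_form P v = 0 -> P *m v = 0.
Proof.
move=> Ps P0 v0; suff uPv u : (u^T *m P *m v) 0 0 = 0.
  apply/colP => i; rewrite !mxE -[RHS](uPv (delta_mx i 0)).
  by rewrite trmx_delta -mulmxA -rowE !mxE.
set b := (u^T *m P *m v) 0 0; apply/eqP/negPn/negP => b0.
(* This multiple of v makes the value of the form equal to -1. *)
have := P0 (u + - ((quadratic_form P u + 1) / (2 * b)) *: v).
rewrite quadratic_formDZ// -/b v0 mulr0 addr0.
have -> : 2 * (- ((quadratic_form P u + 1) / (2 * b))) * b =
          - (quadratic_form P u + 1) by field.
by lra.
Qed.

Lemma psd_diag0 {P} i j : P^T = P -> positive_semidefinite P ->
  P i i = 0 -> P j i = 0.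
Proof.
move=> Ps P0 Pii; have := psd_kernel Ps P0 (v := delta_mx i 0).
by rewrite quadratic_form_delta -colE => /(_ Pii)/colP/(_ j); rewrite !mxE.
Qed.

(** A step of the outer product Cholesky factorization: the value of the
    deflated form at v is the minimum of the form of P over the line through v
    in the direction of the i-th basis vector. *)
Lemma psd_deflate {P} i : P^T = P -> positive_semidefinite P -> P i i != 0 ->
  positive_semidefinite (P - (P i i)^-1 *: (col i P *m (col i P)^T)).
Proof.
move=> Ps P0 Pii v; set w := col i P.
pose t := - ((v^T *m w) 0 0 / P i i).
have := P0 (v + t *: delta_mx i 0).
rewrite quadratic_formDZ// quadratic_form_delta -mulmxA -colE -/w.
rewrite {2}/quadratic_form mulmxBr mulmxBl -scalemxAr -scalemxAl -scaleNr.
rewrite mx11D mx11Z -/(quadratic_form P v) -/(quadratic_form (w *m w^T) v).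
rewrite quadratic_form_outer.
suff -> : quadratic_form P v + 2 * t * (v^T *m w) 0 0 + t ^+ 2 * P i i =
  quadratic_form P v + - (P i i)^-1 * (v^T *m w) 0 0 ^+ 2 by [].
by rewrite /t; field.
Qed.

(** Deflation writes P as a sum of nonnegative multiples of matrices w w^T, and
    the trace of w w^T Q is the value of the form of Q at w. The induction is on
    the number of nonzero diagonal entries: deflating at i clears the i-th one,
    and the zero ones stay zero because their whole row is zero. *)
Lemma psd_trace_mul_ge0 {P Q} : P^T = P -> positive_semidefinite P ->
  positive_semidefinite Q -> 0 <= \tr (P *m Q).
Proof.
move=> + + Q0; have [m] := ubnP #|[set i | P i i != 0]%SET|.
elim: m P => // m IHm P ltm Ps P0.
have [i Pii|diag0] := pickP (fun i => P i i != 0); last first.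
  have -> : P = 0.
    apply/matrixP => j i; rewrite mxE psd_diag0//.
    by apply/eqP/negbFE/diag0.
  by rewrite mul0mx mxtrace0.
set w := col i P; pose P' := P - (P i i)^-1 *: (w *m w^T).
have -> : P = P' + (P i i)^-1 *: (w *m w^T) by rewrite /P' subrK.
rewrite mulmxDl -scalemxAl linearD linearZ/= trace_outer_mul.
have Pii0 : 0 <= P i i by rewrite -quadratic_form_delta.
rewrite addr_ge0 ?mulr_ge0 ?invr_ge0//; apply: IHm; last exact: psd_deflate.
- rewrite -ltnS; apply: leq_trans ltm; rewrite ltnS; apply: proper_card.
  apply/properP; split.
    apply/fintype.subsetP => j; rewrite !inE; apply: contraNneq => Pjj.
    have Pij : P i j = 0 by apply: psd_diag0.
    have Pji : P j i = 0 by rewrite -Ps mxE.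
    by rewrite /P' !mxE big_ord1 !mxE Pjj Pji mul0r mulr0 subr0.
  exists i; first by rewrite inE.
  by rewrite inE /P' !mxE big_ord1 !mxE negbK mulrA mulVf// mul1r subrr.
- by rewrite /P' linearB linearZ/= trmx_mul trmxK Ps.
Qed.

End QuadraticForms.

(** * The smallest eigenvalue of a symmetric matrix *)

Section SmallestEigenvalue.
Context {R : realType} {n : nat}.
Implicit Types (A P Q : 'M[R]_n) (u v w : 'cV[R]_n) (X Y : symmx R n).

Lemma quadratic_form_continuous A :
  continuous (fun x : 'rV[R]_n => quadratic_form A x^T).
Proof.
rewrite (_ : (fun _ => _) =
  fun x : 'rV[R]_n => \sum_j \sum_i x 0 i * A i j * x 0 j); last first.
  apply/funext => x; rewrite /quadratic_form trmxK mxE; apply: eq_bigr => j _.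
  by rewrite !mxE mulr_suml.
have coordc k : continuous (fun x : 'rV[R]_n => x 0 k).
  by exact: coord_continuous.
apply: (continuous_big add_continuous) => j _.
apply: (continuous_big add_continuous) => i _ x.
exact: (cvgM (cvgM (coordc i x) (cvg_cst _)) (coordc j x)).
Qed.

Lemma quadratic_form1 v : quadratic_form 1%:M v = \sum_i v i 0 ^+ 2.
Proof. by rewrite /quadratic_form mulmx1 trmx_mulE_sum. Qed.

Lemma unit_vector_compact : compact [set x : 'rV[R]_n | unit_vector x^T].
Proof.
apply: bounded_closed_compact.
  exists 1; split; first exact: num_real.
  move=> r r1 x /= x1; apply: le_trans (ltW r1).
  rewrite [leLHS]/Num.norm/= mx_normrE; apply/bigmax_leP.
  split=> // -[i j] _ /=.
  rewrite -(ler_pXn2r (n := 2)) ?nnegrE// expr1n real_normK ?num_real//.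
  rewrite -x1 (bigD1 j)//= mxE ord1 lerDl sumr_ge0// => k _.
  exact: sqr_ge0.
rewrite (_ : [set x | _] =
  (fun x : 'rV[R]_n => quadratic_form 1%:M x^T) @^-1` [set 1]).
  apply: closed_comp; last exact: closed_eq.
  by move=> x _; exact: quadratic_form_continuous.
by apply/seteqP; split=> x /=; rewrite quadratic_form1.
Qed.

Lemma quadratic_form_min A : (0 < n)%N ->
  exists2 v, unit_vector v &
    forall u, unit_vector u -> quadratic_form A v <= quadratic_form A u.
Proof.
move=> n0; pose S := [set x : 'rV[R]_n | unit_vector x^T].
have S0 : S !=set0.
  pose i0 := Ordinal n0; exists (delta_mx 0 i0).
  rewrite /S/= /unit_vector (bigD1 i0)//= big1 => [|j ji0].
    by rewrite !mxE !eqxx expr1n addr0.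
  by rewrite !mxE (negbTE ji0) andbF expr0n.
have [|x] :=
    @EVT_min_rV R n (fun x => quadratic_form A x^T) _ S0 unit_vector_compact.
  by apply: continuous_subspaceT; exact: quadratic_form_continuous.
rewrite inE => x1 minx; exists x^T => // u u1.
by have := minx u^T; rewrite trmxK inE; apply; rewrite /S/= trmxK.
Qed.

Lemma quadratic_form_ge_of_unit A m :
  (forall u, unit_vector u -> m <= quadratic_form A u) ->
  forall u, m * (u^T *m u) 0 0 <= quadratic_form A u.
Proof.
move=> mA u; have [u0|u0] := eqVneq ((u^T *m u) 0 0) 0.
  rewrite (trmx_mul_eq0 _ u0).
  by rewrite /quadratic_form !mulmx0 mxE mulr0.
have ugt0 : 0 < (u^T *m u) 0 0 by rewrite lt_neqAle eq_sym u0 trmx_mul_ge0.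
set s := (u^T *m u) 0 0 in u0 ugt0 *.
have sN : (Num.sqrt s)^-1 ^+ 2 = s^-1 by rewrite exprVn sqr_sqrtr// ltW.
have := mA ((Num.sqrt s)^-1 *: u).
rewrite quadratic_formZ sN mulrC ler_pdivlMr//; apply.
rewrite /unit_vector -[RHS](mulVf u0) -sN {3}/s trmx_mulE_sum mulr_sumr.
by apply: eq_bigr => i _; rewrite mxE exprMn.
Qed.

Lemma quadratic_formB_scalar A m u :
  quadratic_form (A - m%:M) u = quadratic_form A u - m * (u^T *m u) 0 0.
Proof.
rewrite /quadratic_form mulmxBr mulmxBl -scaleN1r mx11D mx11Z mulN1r.
by rewrite mul_mx_scalar -scalemxAl mx11Z.
Qed.

Lemma psd_subr_scalar A m :
  (forall u, m * (u^T *m u) 0 0 <= quadratic_form A u) <->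
  positive_semidefinite (A - m%:M).
Proof.
by split=> H u; have := H u; rewrite quadratic_formB_scalar subr_ge0.
Qed.

(** With m the minimum of the form on the unit sphere, attained at v, the
    matrix A - m is positive semidefinite and its form vanishes at v. Hence v
    is in its kernel, that is, v is an eigenvector of A for m. *)
Lemma exists_min_eigenvalue A : (0 < n)%N -> A^T = A ->
  exists2 m, eigenvalue A m & positive_semidefinite (A - m%:M).
Proof.
move=> n0 As; have [v v1 minv] := quadratic_form_min A n0.
set m := quadratic_form A v in minv *.
have psdB := (psd_subr_scalar A m).1 (quadratic_form_ge_of_unit _ _ minv).
have Bs : (A - m%:M)^T = A - m%:M by rewrite linearB/= As tr_scalar_mx.
exists m => //; apply/eigenvalueP; exists v^T; last first.
  apply: contra_eq_neq v1 => /(congr1 trmx); rewrite trmxK trmx0 => ->.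
  rewrite /unit_vector big1 => [|i _]; first by rewrite eq_sym oner_eq0.
  by rewrite mxE expr0n.
have Bv0 : quadratic_form (A - m%:M) v = 0.
  by rewrite quadratic_formB_scalar trmx_mulE_sum v1 mulr1 subrr.
apply: trmx_inj; rewrite trmx_mul trmxK As linearZ/= trmxK.
apply/eqP; rewrite -subr_eq0 -mul_scalar_mx -mulmxBl.
by rewrite psd_kernel.
Qed.

Lemma eigenvalue_ge A m l : positive_semidefinite (A - m%:M) ->
  eigenvalue A l -> m <= l.
Proof.
move=> psdB /eigenvalueP[x xA x0].
have xx : 0 < (x *m x^T) 0 0.
  rewrite -[x in x *m _]trmxK lt_neqAle trmx_mul_ge0 andbT eq_sym.
  apply: contraNneq x0 => /trmx_mul_eq0/(congr1 trmx).
  by rewrite trmxK trmx0 => ->.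
have := (psd_subr_scalar A m).2 psdB x^T.
by rewrite /quadratic_form trmxK xA -scalemxAl mx11Z ler_pM2r.
Qed.

(** X - m is positive semidefinite for the smallest eigenvalue m of X, and so
    is Y; the trace of their product is Y . X - m because Y has trace 1. *)
Lemma lambda_min_le X Y : spectahedron Y -> lambda_min X <= frobenius Y X.
Proof.
move=> [Y0 Y1]; have [n0|] := posnP n.
  (* There is no matrix of size 0 and trace 1. *)
  move: Y1; rewrite /mxtrace big1 => [/esym/eqP|i _]; first by rewrite oner_eq0.
  by have := leq_ltn_trans (leq0n i) (ltn_ord i); rewrite lt0n (introT eqP n0).
move=> n0; have [m mX psdB] := exists_min_eigenvalue _ n0 (symmx_sym X).
apply: (@le_trans _ _ m).
  apply: ge_inf => //; exists m => l/=; exact: eigenvalue_ge.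
have := psd_trace_mul_ge0 (symmx_sym Y) Y0 psdB.
rewrite mulmxBr linearB/= mul_mx_scalar linearZ/= Y1 mulr1 subr_ge0.
by rewrite /frobenius symmx_sym.
Qed.

End SmallestEigenvalue.

(** * Gradients and convexity *)

Section Gradient.
Context {R : realType} {n : nat}.
Implicit Types (f : symmx R n -> R) (X Y H V : symmx R n).

Lemma frobeniusN X Y : frobenius (- X) Y = - frobenius X Y.
Proof. by rewrite -scaleN1r frobeniusZl mulN1r. Qed.

Lemma frobeniusBl X Y H : frobenius (X - Y) H = frobenius X H - frobenius Y H.
Proof. by rewrite frobeniusDl frobeniusN. Qed.

Lemma frobenius_outer v X :
  frobenius (outer v) X = quadratic_form (symmx_val X) v.
Proof. by rewrite /frobenius symmx_sym trace_outer_mul. Qed.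

Lemma symmx_delta_symmetric i j :
  (2^-1 *: (delta_mx i j + delta_mx j i) : 'M[R]_n) \is symmetricmx.
Proof.
apply/symmetricmxP; rewrite linearZ linearD/=.
by rewrite !trmx_delta addrC.
Qed.

(** The projection of the matrix unit on the symmetric matrices. The
    coefficients in [symmx_sum_delta] are the matrix entries, so that the
    gradient has the entries 'd f X (symmx_delta i j). *)
Definition symmx_delta i j : symmx R n := SymMx (symmx_delta_symmetric i j).

Lemma symmx_deltaC i j : symmx_delta i j = symmx_delta j i.
Proof. by apply: val_inj; rewrite /= addrC. Qed.

Lemma symmx_sum_delta X :
  X = \sum_i \sum_j symmx_val X i j *: symmx_delta i j.
Proof.
apply: val_inj; rewrite (raddf_sum val).
under eq_bigr do rewrite (raddf_sum val).
have XE := matrix_sum_delta (symmx_val X).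
transitivity (2^-1 *: (symmx_val X + (symmx_val X)^T)).
  rewrite symmx_sym -mulr2n -[X in _ *: X]scaler_nat scalerA.
  by rewrite mulVf ?scale1r ?pnatr_eq0.
rewrite {2}XE raddf_sum/= {1}XE -big_split scaler_sumr; apply: eq_bigr => i _.
rewrite raddf_sum/= -big_split scaler_sumr; apply: eq_bigr => j _.
rewrite linearZ/= trmx_delta -scalerDr scalerA mulrC -scalerA.
by [].
Qed.

(** The existence of a Riesz representative, so that [gradient] is not the
    default value of the choice operator. *)
Lemma gradientP f X H : 'd f X H = frobenius H (gradient f X).
Proof.
pose g : 'M[R]_n := \matrix_(i, j) ('d f X (symmx_delta i j) : R).
have gs : g \is symmetricmx.
  by apply/symmetricmxP/matrixP => i j; rewrite !mxE symmx_deltaC.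
have : [set G | forall H, 'd f X H = frobenius H G] (SymMx gs); last first.
  by move=> /getI; apply.
move=> {}H /=.
rewrite {1}(symmx_sum_delta H) raddf_sum frobeniusE; apply: eq_bigr => i _.
rewrite raddf_sum; apply: eq_bigr => j _.
have dZ (a : R) (Z : symmx R n) : 'd f X (a *: Z) = a *: ('d f X Z : R).
  exact: linearZ_LR.
by rewrite [LHS]dZ mxE.
Qed.

(** By convexity the difference quotients of f at X towards Y are at most
    f Y - f X for steps h <= 1; the left-hand side is their limit at 0+. *)
Lemma convex_gradient_ineq f X Y : convex_function [set: symmx R n] f ->
  differentiable f X -> frobenius (Y - X) (gradient f X) <= f Y - f X.
Proof.
move=> cf df; rewrite -gradientP -deriveE//.
have dcvg := diff_derivable (v := Y - X) df.
rewrite /derive.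
apply: (cvgr_to_le (cvg_dnbhs_at_right dcvg)).
near=> h; have h0 : 0 < h by near: h; exact: nbhs_right_gt.
have h1 : h <= 1 by near: h; exact: nbhs_right_le.
rewrite /= -[_ *: _]/(h^-1 * _) ler_pdivrMl//.
have fh : f (h *: Y + (1 - h) *: X) <= h * f Y + (1 - h) * f X.
  by apply: (cf (Itv01 (ltW h0) h1)); rewrite inE.
have -> : h *: (Y - X) + X = h *: Y + (1 - h) *: X.
  by rewrite scalerBr scalerBl scale1r -addrA [- _ + X]addrC.
lra.
Unshelve. all: by end_near. Qed.

End Gradient.

(** * One greedy step *)

Section GreedyStep.
Context {R : realType} {n : nat}.
Implicit Types (f : symmx R n -> R) (X Y V : symmx R n) (v : 'cV[R]_n).

Lemma symmx_val_conv X V (a : R) : symmx_val (X + a *: (V - X)) =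
  (1 - a) *: symmx_val X + a *: symmx_val V.
Proof.
have -> : X + a *: (V - X) = (1 - a) *: X + a *: V.
  by rewrite scalerBr scalerBl scale1r addrA addrAC.
have valZ (b : R) Z : symmx_val (b *: Z) = b *: symmx_val Z.
  exact: (linearZ_LR val).
by rewrite -!valZ; exact: (raddfD val).
Qed.

Lemma outer_spectahedron v : unit_vector v -> spectahedron (outer v).
Proof.
move=> v1; split=> [u|]; first by rewrite quadratic_form_outer sqr_ge0.
by rewrite /= mxtrace_mulC trace_mx11 trmx_mulE_sum.
Qed.

Lemma spectahedron_conv X V (a : R) : 0 <= a <= 1 ->
  spectahedron X -> spectahedron V -> spectahedron (X + a *: (V - X)).
Proof.
move=> /andP[a0 a1] [X0 X1] [V0 V1]; split; rewrite symmx_val_conv; last first.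
  by rewrite linearD !linearZ/= X1 V1; ring.
move=> u; rewrite /quadratic_form mulmxDr mulmxDl -!scalemxAr -!scalemxAl.
rewrite mx11D !mx11Z addr_ge0// mulr_ge0 ?subr_ge0//; [exact: X0|exact: V0].
Qed.

(** The choice V = X contributes 0 to the supremum. *)
Lemma curvature_ge0 f (C : R) X :
  spectahedron X -> curvature f = C%:E -> 0 <= C.
Proof.
move=> SX fC; rewrite -lee_fin -fC; apply: ereal_sup_ubound.
exists X, X, 1; split=> //; first by rewrite ltr01 lexx.
rewrite /= subrr scaler0 addr0 !subrr -(scale0r (0 : symmx R n)) frobeniusZl.
by rewrite mul0r subr0 mulr0.
Qed.

Lemma curvature_ineq f (C : R) X V (a : R) : curvature f = C%:E ->
  spectahedron X -> spectahedron V -> 0 < a <= 1 ->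
  f (X + a *: (V - X)) <=
    f X + a * frobenius (V - X) (gradient f X) + a ^+ 2 * C.
Proof.
move=> fC SX SV a01; have a0 : 0 < a by case/andP: a01.
set Y := X + _; have YX : Y - X = a *: (V - X) by rewrite /Y addrC addKr.
have : ((1 / a ^+ 2 *
    (f Y - f X - frobenius (Y - X) (gradient f X)))%:E <= C%:E)%E.
  by rewrite -fC; apply: ereal_sup_ubound; exists X, V, a.
rewrite lee_fin mul1r mulrC ler_pdivrMr ?exprn_gt0// YX frobeniusZl.
by rewrite [C * _]mulrC; lra.
Qed.

(** The closed form of the duality gap: what a step along an approximate
    eigenvector gains is the step size times it, up to errors of second order
    in the step size. *)
Definition eigenvalue_gap f X : R :=
  frobenius X (gradient f X) - lambda_min (gradient f X).

Lemma frobenius_le_eigenvalue_gap f X Y : spectahedron Y ->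
  frobenius (X - Y) (gradient f X) <= eigenvalue_gap f X.
Proof. by move=> SY; rewrite frobeniusBl lerB// lambda_min_le. Qed.

Lemma duality_gap_le f X :
  spectahedron X -> duality_gap f X <= eigenvalue_gap f X.
Proof.
move=> SX; apply: ge_sup; first by exists (frobenius (X - X) (gradient f X)), X.
by move=> _ [Y SY <-]; exact: frobenius_le_eigenvalue_gap.
Qed.

Lemma suboptimality_le_eigenvalue_gap f X Y :
  convex_function [set: symmx R n] f -> differentiable f X -> spectahedron Y ->
  f X - f Y <= eigenvalue_gap f X.
Proof.
move=> cf df SY; apply: le_trans (frobenius_le_eigenvalue_gap f X _ SY).
have := convex_gradient_ineq f X Y cf df.
by rewrite -(opprB X) frobeniusN lerNl opprB.
Qed.

(** The error term counts a ^+ 2 * C twice: once for the curvature, and once for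
    the tolerance a * C of the eigenvector, weighted by the step a. *)
Lemma greedy_step_descent f (C : R) X v (a : R) : curvature f = C%:E ->
  spectahedron X -> 0 < a <= 1 -> approx_ev (gradient f X) (a * C) v ->
  f (X + a *: (outer v - X)) <=
    f X - a * eigenvalue_gap f X + 2 * a ^+ 2 * C.
Proof.
move=> fC SX a01 [v1 vC]; have a0 : 0 < a by case/andP: a01.
have Sv := outer_spectahedron _ v1.
apply: le_trans (curvature_ineq f C X _ a fC SX Sv a01) _.
rewrite frobeniusBl frobenius_outer /eigenvalue_gap.
move: vC; rewrite -(ler_pM2l a0).
by set q := quadratic_form _ _; set l := lambda_min _; lra.
Qed.

Lemma mxrank_greedy_step X v (a : R) :
  (\rank (symmx_val (X + a *: (outer v - X))%R) <= (\rank (symmx_val X)).+1)%N.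
Proof.
rewrite symmx_val_conv -addn1; apply: leq_trans (mxrank_add _ _) _.
apply: leq_add; first exact: mxrank_scale.
apply: leq_trans (mxrank_scale _ _) _; apply: leq_trans (mxrankM_maxl _ _) _.
exact: rank_leq_col.
Qed.

End GreedyStep.

(** * Step sizes *)

Section StepSizeArithmetic.
Context {R : realType}.

Lemma step_size_itv k : 0 < step_size R k <= 1.
Proof.
rewrite /step_size divr_gt0 ?ler_pdivrMr ?mul1r ?lerDr//=.
all: by rewrite ltr_wpDl.
Qed.

Lemma step_size_upto_itv K k : 0 < step_size_upto R K k <= 1.
Proof. by rewrite /step_size_upto; case: ifP => _; exact: step_size_itv. Qed.

(** The bound for k + 1 exceeds what the recursion yields by exactly
    8 C / ((k + 3) (k + 2)^2). *)
Lemma suboptimality_bound_step (C h h' : R) k : 0 <= C ->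
  h <= 8 * C / (k%:R + 2) ->
  h' <= (1 - step_size R k) * h + 2 * step_size R k ^+ 2 * C ->
  h' <= 8 * C / (k.+1%:R + 2).
Proof.
move=> C0 hk /le_trans; apply; rewrite /step_size -(natr1 k).
set x : R := k%:R in hk *; have x0 : 0 <= x by exact: ler0n.
have x2 : 0 < x + 2 by lra.
have x3 : 0 < x + 1 + 2 by lra.
have -> : 1 - 2 / (x + 2) = x / (x + 2) by field; rewrite !gt_eqF.
have xx0 : 0 <= x / (x + 2) by rewrite divr_ge0// ltW.
have := ler_wpM2l xx0 hk => hx.
have : x / (x + 2) * (8 * C / (x + 2)) + 2 * (2 / (x + 2)) ^+ 2 * C <=
   8 * C / (x + 1 + 2); last by lra.
rewrite -subr_ge0.
have -> : 8 * C / (x + 1 + 2) -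
  (x / (x + 2) * (8 * C / (x + 2)) + 2 * (2 / (x + 2)) ^+ 2 * C) =
  8 * C / ((x + 1 + 2) * (x + 2) ^+ 2) by field; rewrite !gt_eqF.
by rewrite divr_ge0 ?mulr_ge0 ?exprn_ge0// ltW.
Qed.

(** The step size is 1, so the value h at the starting point is forgotten. *)
Lemma suboptimality_bound_init (C h h' : R) : 0 <= C ->
  h' <= (1 - step_size R 0) * h + 2 * step_size R 0 ^+ 2 * C ->
  h' <= 8 * C / (1%:R + 2).
Proof.
move=> C0; rewrite /step_size !add0r divff// subrr mul0r add0r expr1n mulr1.
move=> /le_trans; apply; rewrite ler_pdivlMr; lra.
Qed.

(** By 8 C <= K e, it is enough to compare multiples of e: with x = K, the right
    side exceeds the left by at least
    e (4 x^2 + 15 x + 12) / ((x + 3) (x + 2)^2). *)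
Lemma total_decrease_lt (C e : R) K : 0 <= C -> 0 < e -> 8 * C <= K%:R * e ->
  8 * C / (K.+1%:R + 2) <
  K.+1%:R * (step_size R K * e - 2 * step_size R K ^+ 2 * C).
Proof.
move=> C0 e0; rewrite /step_size -(natr1 K).
set x : R := K%:R; have x0 : 0 <= x by exact: ler0n.
move=> CK; have x2 : 0 < x + 2 by lra.
have x3 : 0 < x + 1 + 2 by lra.
set D := 8 * C in CK *.
have -> : 2 * (2 / (x + 2)) ^+ 2 * C = D / (x + 2) ^+ 2.
  by rewrite /D; field; rewrite gt_eqF.
have D1 : D / (x + 1 + 2) <= x * e / (x + 1 + 2) by rewrite ler_pM2r ?invr_gt0.
have D2 : D / (x + 2) ^+ 2 <= x * e / (x + 2) ^+ 2.
  by rewrite ler_pM2r ?invr_gt0 ?exprn_gt0.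
apply: le_lt_trans D1 _.
have x1 : 0 < x + 1 by lra.
apply: (@lt_le_trans _ _ ((x + 1) * (2 / (x + 2) * e - x * e / (x + 2) ^+ 2))).
  rewrite -subr_gt0.
  have -> : (x + 1) * (2 / (x + 2) * e - x * e / (x + 2) ^+ 2) -
            x * e / (x + 1 + 2) =
    e * (4 * x ^+ 2 + 15 * x + 12) / ((x + 1 + 2) * (x + 2) ^+ 2).
    by field; rewrite !gt_eqF.
  rewrite divr_gt0 ?mulr_gt0 ?exprn_gt0//.
  have : 0 <= x ^+ 2 by exact: sqr_ge0.
  lra.
rewrite ler_pM2l//; lra.
Qed.

Lemma half_steps_ge (C e : R) : 0 < e -> 8 * C <= (half_steps C e)%:R * e.
Proof.
move=> e0; rewrite -ler_pdivrMr// natr_absz.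
apply: le_trans (ceil_ge _) _.
by rewrite ler_int ler_norm.
Qed.

Lemma half_steps_le (C e : R) : 0 < e ->
  (half_steps C e)%:R <= 8 * `|C| / e + 1.
Proof.
move=> e0; rewrite natr_absz intr_norm.
have := ceilB1_lt (8 * C / e); have := ceil_ge (8 * C / e).
rewrite intrB; set c := _%:~R => xc cx.
have := ler_norm (8 * C / e); have := ler_norm (- (8 * C / e)).
rewrite normrN normrM normfV [`|e|]gtr0_norm// normrM [`|8|]gtr0_norm//.
by case: (ger0P c) => _; lra.
Qed.

(** The number of steps and the rank bound are both affine functions of the
    number of half steps. *)
Lemma affine_half_steps_bigO (a b : nat) (C : R) :
  (fun e : R => (a * half_steps C e + b)%:R : R) =O_ (0^'+) (fun e : R => e^-1).
Proof.
apply/eqO_exP; pose M : R := a%:R * (8 * `|C| + 1) + b%:R + 1.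
have M0 : 0 < M.
  by rewrite ltr_wpDl// addr_ge0// mulr_ge0// addr_ge0// mulr_ge0.
(* For e <= 1 the constant terms are absorbed by their product with e^-1. *)
exists M => //; near=> e.
have e0 : 0 < e by near: e; exact: nbhs_right_gt.
have e1 : e <= 1 by near: e; exact: nbhs_right_le.
rewrite ger0_norm// [`|e^-1|]gtr0_norm ?invr_gt0//.
have ei1 : 1 <= e^-1 by rewrite invr_ge1 ?unitfE ?gt_eqF.
rewrite natrD natrM.
have hsC : (half_steps C e)%:R <= (8 * `|C| + 1) * e^-1.
  apply: le_trans (half_steps_le C e e0) _.
  by rewrite [leRHS]mulrDl mul1r lerD2l.
have : a%:R * (half_steps C e)%:R <= a%:R * ((8 * `|C| + 1) * e^-1).
  by rewrite ler_wpM2l.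
have : b%:R * 1 <= b%:R * e^-1 by rewrite ler_wpM2l.
rewrite /M; set i := e^-1 in ei1 *; lra.
Unshelve. all: by end_near. Qed.

End StepSizeArithmetic.

(** * Runs of the greedy algorithm *)

Section GreedyRun.
Context {R : realType} {n : nat}.
Context (f : symmx R n -> R) (C : R) (Xs : symmx R n).
Context (a : nat -> R) (X : nat -> symmx R n).
Context (f_convex : convex_function [set: symmx R n] f).
Context (f_diff : forall Y, differentiable f Y).
Context (f_curv : curvature f = C%:E).
Context (Xs_min : minimizer f Xs).
Context (a01 : forall k, 0 < a k <= 1).
Context (greedyX : sparse_greedy f a X).

Lemma greedy_spectahedron k : spectahedron (X k).
Proof.
have [[v v1 X0] stepX] := greedyX.
elim: k => [|k IHk]; first by rewrite X0; exact: outer_spectahedron.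
have [w [w1 _] ->] := stepX k.
apply: spectahedron_conv => //; last exact: outer_spectahedron.
by have /andP[/ltW-> ->] := a01 k.
Qed.

Lemma greedy_rank k : (\rank (symmx_val (X k)) <= k.+1)%N.
Proof.
have [[v v1 X0] stepX] := greedyX; elim: k => [|k IHk].
  by rewrite X0; apply: leq_trans (mxrankM_maxl _ _) _; exact: rank_leq_col.
have [w _ ->] := stepX k.
by apply: leq_trans (mxrank_greedy_step _ _ _) _; rewrite ltnS.
Qed.

Lemma greedy_descent k :
  f (X k.+1) <= f (X k) - a k * eigenvalue_gap f (X k) + 2 * a k ^+ 2 * C.
Proof.
have [w wC ->] := greedyX.2 k; rewrite f_curv/= in wC.
exact: greedy_step_descent f_curv (greedy_spectahedron k) (a01 k) wC.
Qed.

Lemma greedy_suboptimality_recursion k :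
  f (X k.+1) - f Xs <=
    (1 - a k) * (f (X k) - f Xs) + 2 * a k ^+ 2 * C.
Proof.
have := greedy_descent k.
have := suboptimality_le_eigenvalue_gap f (X k) Xs f_convex (f_diff _) Xs_min.1.
have /andP[ak0 _] := a01 k; rewrite -(ler_pM2l ak0).
by set g := eigenvalue_gap _ _; lra.
Qed.

Lemma greedy_convergence k :
  (forall j, (j <= k)%N -> a j = step_size R j) ->
  f (X k.+1) - f Xs <= 8 * C / (k.+1%:R + 2).
Proof.
have C0 : 0 <= C := curvature_ge0 f C Xs Xs_min.1 f_curv.
elim: k => [|k IHk] ak; have rec := greedy_suboptimality_recursion.
  by apply: (suboptimality_bound_init C (f (X 0%N) - f Xs)) => //; rewrite -ak.
apply: (suboptimality_bound_step C (f (X k.+1) - f Xs)) => //;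
  last by rewrite -ak.
by apply: IHk => j jk; apply: ak; exact: leqW.
Qed.

Lemma greedy_decrease K (s e : R) m :
  (forall j, (K <= j)%N -> a j = s) ->
  (forall j, (j < m)%N -> e <= eigenvalue_gap f (X (K + j))) ->
  f (X (K + m)) <= f (X K) - m%:R * (s * e - 2 * s ^+ 2 * C).
Proof.
move=> aK; elim: m => [|m IHm] gapX; first by rewrite addn0 mul0r subr0.
have := IHm (fun j jm => gapX j (leqW jm)).
have := greedy_descent (K + m); have := gapX m (ltnSn m).
have /andP[s0 _] := a01 (K + m); rewrite -(ler_pM2l s0).
rewrite aK ?leq_addr// addnS -(natr1 m).
by set g := eigenvalue_gap _ _; lra.
Qed.

End GreedyRun.

(** Otherwise the iterates K + 1, ..., 2 K + 1 all have a gap larger than e, and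
    the iterate 2 K + 2 lies below the minimum. Starting from K + 1
    rather than K is what covers K = 0: the bound on the
    suboptimality is available only after the first step. *)
Lemma greedy_duality_gap (R : realType) n (f : symmx R n -> R) (C : R) Xs X e :
  convex_function [set: symmx R n] f -> (forall Y, differentiable f Y) ->
  curvature f = C%:E -> minimizer f Xs -> 0 < e ->
  sparse_greedy f (step_size_upto R (half_steps C e)) X ->
  exists2 k, (k <= 2 * half_steps C e + 1)%N & duality_gap f (X k) <= e.
Proof.
move=> cf df fC Xsm e0; set K := half_steps C e => gX.
have C0 : 0 <= C := curvature_ge0 f C Xs Xsm.1 fC.
have a01 := step_size_upto_itv (R := R) K.
apply: contrapT => nogap.
have gapX j : (j < K.+1)%N -> e <= eigenvalue_gap f (X (K.+1 + j)%N).
  move=> jK; apply/ltW; rewrite ltNge; apply/negP => gap_le; apply: nogap.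
  exists (K.+1 + j)%N.
    by rewrite addSn addnC mul2n -addnn addn1 ltnS leq_add2r -ltnS.
  apply: le_trans gap_le; apply: duality_gap_le.
  exact: greedy_spectahedron a01 gX _.
have aK j : (K.+1 <= j)%N -> step_size_upto R K j = step_size R K.
  by move=> Kj; rewrite /step_size_upto leqNgt Kj.
have := greedy_decrease f C _ X fC a01 gX K.+1 _ e K.+1 aK gapX.
have ak j : (j <= K)%N -> step_size_upto R K j = step_size R j.
  by rewrite /step_size_upto => ->.
have := greedy_convergence f C Xs _ X cf df fC Xsm a01 gX K ak.
have := total_decrease_lt C e K C0 e0 (half_steps_ge C e e0).
have := Xsm.2 _ (greedy_spectahedron f _ X a01 gX (K.+1 + K.+1)).
lra.
Qed.

Theorem theorem17 (R : realType) :
  exists rank_bound : R -> R -> nat,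
    (forall C : R,
       (fun e : R => (rank_bound C e)%:R : R) =O_ (0^'+) (fun e : R => e^-1)) /\
    (forall C : R,
       (fun e : R => (2 * half_steps C e + 1)%:R : R)
         =O_ (0^'+) (fun e : R => e^-1)) /\
    forall (n : nat) (f : symmx R n -> R) (C : R) (Xs : symmx R n),
      convex_function [set: symmx R n] f ->
      (forall X : symmx R n, differentiable f X) ->
      curvature f = C%:E ->
      minimizer f Xs ->
      (forall X : nat -> symmx R n, sparse_greedy f (@step_size R) X ->
         forall k : nat, (1 <= k)%N -> f (X k) - f Xs <= 8 * C / (k%:R + 2)) /\
      (forall e : R, 0 < e ->
         forall X : nat -> symmx R n,
           sparse_greedy f (@step_size_upto R (half_steps C e)) X ->
           exists k : nat,
             [/\ (k <= 2 * half_steps C e + 1)%N,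
                 (\rank (symmx_val (X k)) <= rank_bound C e)%N &
                 duality_gap f (X k) <= e]).
Proof.
exists (fun C e => 2 * half_steps C e + 2)%N.
split=> [C|]; first exact: affine_half_steps_bigO.
split=> [C|n f C Xs cf df fC Xsm]; first exact: affine_half_steps_bigO.
split=> [X gX [//|k] _|e e0 X gX].
  exact: (greedy_convergence f C Xs _ X cf df fC Xsm step_size_itv gX).
have [k kK gapk] := greedy_duality_gap _ _ f C Xs X e cf df fC Xsm e0 gX.
exists k; split=> //; apply: leq_trans (greedy_rank _ _ _ gX k) _.
by rewrite addn2 ltnS -addn1.
Qed.
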